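(* Let $A$ be a tabular algebra of finite rank with table datum $(\Lambda,\Gamma,B,M,C,* )$; that is, $|B(\lambda)|<\infty$ for each $\lambda\in\Lambda$. Suppose that, for some commutative ring $R\ge\mathbb{Z}$ and for each $\lambda\in\Lambda$, the algebra $R\otimes_{\mathbb{Z}}\Gamma(\lambda)$ is cellular over $R$ with cell datum $(\Lambda_\lambda,M_\lambda,C_\lambda,\bar{\ })$, where $\bar{\ }$ is the table algebra anti-automorphism of $\Gamma(\lambda)$ (extended $R$-linearly). Then $R\otimes_{\mathbb{Z}}A$ is cellular over $R\otimes_{\mathbb{Z}}\mathbb{Z}[v,v^{-1}]$ with cell datum $(\Lambda',M',C',* )$, where $\Lambda':=\{(\lambda,\lambda'):\lambda\in\Lambda,\ \lambda'\in\Lambda_\lambda\}$ is ordered lexicographically, $M'((\lambda,\lambda')):=M(\lambda)\times M_\lambda(\lambda')$, and, for $(S,s),(T,t)\in M(\lambda)\times M_\lambda(\lambda')$, $C'((S,s),(T,t))$ is equal to $C_{S,T}^{C_\lambda(s,t)}$.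
   Context: **Normalized table algebras.** A normalized table algebra over a ring $R$ with $\mathbb{Z}\le R\le\mathbb{C}$ is a pair $(\Gamma,B)$, where $\Gamma$ is an associative unital $R$-algebra (possibly noncommutative or infinite dimensional) and $B$ is an $R$-basis of $\Gamma$ with $1\in B$, such that: (T1) the structure constants of $\Gamma$ with respect to $B$ are nonnegative integers; (T2) there is an $R$-linear algebra anti-automorphism $\bar{\ }$ of $\Gamma$ with square the identity and $\overline{B}=B$; (T3) writing $\kappa(b,a)$ for the coefficient of $b\in B$ in $a\in\Gamma$, one has $\kappa(b'',bb')=\kappa(b,b''\,\overline{b'})$ for all $b,b',b''\in B$. **Tabular algebras.** Let $\mathcal{A}=\mathbb{Z}[v,v^{-1}]$. A tabular algebra is an $\mathcal{A}$-algebra $A$ with a table datum $(\Lambda,\Gamma,B,M,C,* )$ where: (A1) $\Lambda$ is a finite poset. For each $\lambda\in\Lambda$, $(\Gamma(\lambda),B(\lambda))$ is a normalized table algebra over $\mathbb{Z}$ and $M(\lambda)$ is a finite set. The map $C:\coprod_{\lambda\in\Lambda}(M(\lambda)\times B(\lambda)\times M(\lambda))\to A$ is injective with image an $\mathcal{A}$-basis of $A$. The image $\mathrm{Im}(C)$ contains a set of mutually orthogonal idempotents $\{1_\varepsilon:\varepsilon\in\mathcal{E}\}$ such that $A=\sum_{\varepsilon,\varepsilon'}1_\varepsilon A1_{\varepsilon'}$ and each $X\in\mathrm{Im}(C)$ satisfies $X=1_\varepsilon X1_{\varepsilon'}$ for some $\varepsilon,\varepsilon'\in\mathcal{E}$.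 (A2) Write $C_{S,T}^b=C(S,b,T)$ for $S,T\in M(\lambda)$, $b\in B(\lambda)$. Then $*$ is an $\mathcal{A}$-linear involutory anti-automorphism of $A$ with $(C_{S,T}^b)^*=C_{T,S}^{\overline{b}}$, where $\bar{\ }$ is the table algebra anti-automorphism of $\Gamma(\lambda)$. If $g=\sum_i c_ib_i$ with $b_i\in B(\lambda)$ and scalars $c_i$ (possibly in an extension of $\mathbb{Z}$ or involving $v$), $C_{S,T}^g$ denotes $\sum_i c_iC_{S,T}^{b_i}$ (in a suitable scalar extension of $A$). (A3) If $\lambda\in\Lambda$, $g\in\Gamma(\lambda)$, $S,T\in M(\lambda)$, then for all $a\in A$, $a\,C_{S,T}^g\equiv\sum_{S'\in M(\lambda)}C_{S',T}^{r_a(S',S)g}\bmod A(<\lambda)$, where $r_a(S',S)\in\mathcal{A}\otimes_{\mathbb{Z}}\Gamma(\lambda)$ is independent of $T$ and $g$, and $A(<\lambda)$ is the $\mathcal{A}$-span of all $C_{S'',T''}^{b''}$ with $S'',T''\in M(\mu)$, $b''\in B(\mu)$, $\mu<\lambda$. **Cellular algebras.** Let $R$ be a commutative ring with identity. A cellular algebra over $R$ is an associative unital $R$-algebra $A$ with a cell datum $(\Lambda,M,C,* )$ where: (C1) $\Lambda$ is a finite poset; for each $\lambda\in\Lambda$, $M(\lambda)$ is a finite set; and $C:\coprod_{\lambda\in\Lambda}(M(\lambda)\times M(\lambda))\to A$ is injective with image an $R$-basis of $A$. (C2) Writing $C(S,T)=C_{S,T}^\lambda$ for $S,T\in M(\lambda)$,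 $*$ is an $R$-linear involutory anti-automorphism of $A$ with $(C_{S,T}^\lambda)^*=C_{T,S}^\lambda$. (C3) For $\lambda\in\Lambda$, $S,T\in M(\lambda)$, $a\in A$: $a\,C_{S,T}^\lambda\equiv\sum_{S'\in M(\lambda)}r_a(S',S)C_{S',T}^\lambda\bmod A(<\lambda)$, where $r_a(S',S)\in R$ is independent of $T$ and $A(<\lambda)$ is the $R$-span of $\{C_{S'',T''}^\mu:\mu<\lambda,\ S'',T''\in M(\mu)\}$. *)

(* Defs.v *)
From HB Require Import structures.
From mathcomp Require Import all_boot all_order all_algebra.
From mathcomp Require Import finmap.
From mathcomp Require Import boolp classical_sets cardinality.

Set Implicit Arguments.
Unset Strict Implicit.
Unset Printing Implicit Defensive.

Import Order.TTheory GRing.Theory Num.Theory.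

Local Open Scope classical_set_scope.
Local Open Scope quotient_scope.
Local Open Scope ring_scope.

(* Associative unital algebras over a commutative ring R: rings with a central *)
(* ring morphism from R, scalars acting through it. MathComp's algType imposes *)
(* 1 != 0, which would exclude the zero algebra (the tabular or cellular       *)
(* algebra with an empty basis).                                               *)
Record algebra (R : comPzRingType) := Algebra {
  alg_ring : pzRingType;
  alg_map : {rmorphism R -> alg_ring};
  alg_mapC : forall c x, alg_map c * x = x * alg_map c
}.

Definition alg_sort (R : comPzRingType) (A : algebra R) : Type := alg_ring A.
Coercion alg_sort : algebra >-> Sortclass.

Section AlgebraModule.
Variables (R : comPzRingType) (A : algebra R).

HB.instance Definition _ := GRing.PzRing.on (alg_sort A).

Definition alg_scale (c : R) (x : A) : A := alg_map A c * x.

Fact alg_scaleA c d x : alg_scale c (alg_scale d x) = alg_scale (c * d) x.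
Proof. by rewrite /alg_scale rmorphM mulrA. Qed.

Fact alg_scale1 : left_id 1 alg_scale.
Proof. by move=> x; rewrite /alg_scale rmorph1 mul1r. Qed.

Fact alg_scaleDr : right_distributive alg_scale +%R.
Proof. by move=> c x y; rewrite /alg_scale mulrDr. Qed.

Fact alg_scaleDl x : {morph alg_scale^~ x : c d / c + d}.
Proof. by move=> c d; rewrite /alg_scale rmorphD mulrDl. Qed.

HB.instance Definition _ := GRing.Zmodule_isLmodule.Build R (alg_sort A)
  alg_scaleA alg_scale1 alg_scaleDr alg_scaleDl.

Lemma alg_scaleE c x : c *: x = alg_map A c * x :> A.
Proof. by []. Qed.

End AlgebraModule.

Definition biadditive (U V G : zmodType) (f : U -> V -> G) : Prop :=
  (forall v, {morph f^~ v : x y / x + y}) /\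
  (forall u, {morph f u : x y / x + y}).

Definition tsum (U V G : zmodType) (f : U -> V -> G) (s : seq (U * V)) : G :=
  \sum_(p <- s) f p.1 p.2.

(* A list s stands for the sum of the u (x) v with (u, v) in s; two lists     *)
(* have the same sum in the tensor product over Z iff no biadditive map       *)
(* separates them.                                                            *)
Definition teq (U V : zmodType) (s t : seq (U * V)) : bool :=
  `[< forall (G : zmodType) (f : U -> V -> G), biadditive f ->
        tsum f s = tsum f t >].

Section TensorType.
Variables U V : zmodType.
Implicit Types s t : seq (U * V).

Lemma teq_refl : reflexive (@teq U V).
Proof. by move=> s; apply/asboolP. Qed.

Lemma teq_sym : symmetric (@teq U V).
Proof.
by move=> s t; apply/asboolP/asboolP => H G f bf; rewrite (H G f bf).
Qed.

Lemma teq_trans : transitive (@teq U V).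
Proof.
move=> t s u /asboolP H1 /asboolP H2; apply/asboolP => G f bf.
by rewrite H1 // H2.
Qed.

Canonical teq_equiv := EquivRel (@teq U V) teq_refl teq_sym teq_trans.

Definition tens := {eq_quot teq_equiv}%qT.

HB.instance Definition _ : EqQuotient _ teq_equiv tens := EqQuotient.on tens.
HB.instance Definition _ := Choice.on tens.

Definition pure (u : U) (v : V) : tens := \pi_tens [:: (u, v)].

Definition tlift (G : zmodType) (f : U -> V -> G) (x : tens) : G :=
  tsum f (repr x).

Lemma tlift_pi (G : zmodType) (f : U -> V -> G) s :
  biadditive f -> tlift f (\pi_tens s) = tsum f s.
Proof.
move=> bf; rewrite /tlift.
have : repr (\pi_tens s) = s %[mod tens] by rewrite reprK.
by move/eqmodP/asboolP; apply.
Qed.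

Lemma tens_eqP (x y : tens) :
  (forall (G : zmodType) (f : U -> V -> G), biadditive f ->
     tlift f x = tlift f y) -> x = y.
Proof.
move=> H; rewrite -[x]reprK -[y]reprK; apply/eqmodP/asboolP => G f bf.
exact: H.
Qed.

Definition tens_zero : tens := \pi_tens [::].
Definition tens_add (x y : tens) : tens := \pi_tens (repr x ++ repr y).
Definition tens_opp (x : tens) : tens :=
  \pi_tens [seq (- p.1, p.2) | p <- repr x].

Lemma biadditiveNl (G : zmodType) (f : U -> V -> G) u v :
  biadditive f -> f (- u) v = - f u v.
Proof.
move=> [fl _]; have f0 : f 0 v = 0.
  by apply: (addrI (f 0 v)); rewrite -(fl v) !addr0.
by apply: (addrI (f u v)); rewrite -(fl v) !subrr f0.
Qed.

Lemma tlift_zero (G : zmodType) (f : U -> V -> G) :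
  biadditive f -> tlift f tens_zero = 0.
Proof. by move=> bf; rewrite tlift_pi // /tsum big_nil. Qed.

Lemma tlift_add (G : zmodType) (f : U -> V -> G) x y :
  biadditive f -> tlift f (tens_add x y) = tlift f x + tlift f y.
Proof. by move=> bf; rewrite tlift_pi // /tsum big_cat. Qed.

Lemma tlift_opp (G : zmodType) (f : U -> V -> G) x :
  biadditive f -> tlift f (tens_opp x) = - tlift f x.
Proof.
move=> bf; rewrite tlift_pi // /tsum big_map -sumrN.
by apply: eq_bigr => p _ /=; rewrite biadditiveNl.
Qed.

Lemma tens_addA : associative tens_add.
Proof.
by move=> x y z; apply: tens_eqP => G f bf; rewrite !tlift_add // addrA.
Qed.

Lemma tens_addC : commutative tens_add.
Proof.
by move=> x y; apply: tens_eqP => G f bf; rewrite !tlift_add // addrC.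
Qed.

Lemma tens_add0 : left_id tens_zero tens_add.
Proof.
move=> x; apply: tens_eqP => G f bf.
by rewrite tlift_add // tlift_zero // add0r.
Qed.

Lemma tens_addN : left_inverse tens_zero tens_opp tens_add.
Proof.
move=> x; apply: tens_eqP => G f bf.
by rewrite tlift_add // tlift_opp // tlift_zero // addNr.
Qed.

HB.instance Definition _ :=
  GRing.isZmodule.Build tens tens_addA tens_addC tens_add0 tens_addN.

Lemma tliftD (G : zmodType) (f : U -> V -> G) :
  biadditive f -> {morph tlift f : x y / x + y}.
Proof. by move=> bf x y; apply: tlift_add. Qed.

Lemma tlift0 (G : zmodType) (f : U -> V -> G) : biadditive f -> tlift f 0 = 0.
Proof. exact: tlift_zero. Qed.

Lemma tlift_pure (G : zmodType) (f : U -> V -> G) u v :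
  biadditive f -> tlift f (pure u v) = f u v.
Proof. by move=> bf; rewrite tlift_pi // /tsum big_seq1. Qed.

Lemma pure_biadditive : biadditive pure.
Proof.
by split=> [v x y|u x y]; apply: tens_eqP => G f bf;
  rewrite (tliftD bf) !tlift_pure //; case: bf => [fl fr]; rewrite (fl, fr).
Qed.

Lemma pureDl u u' v : pure (u + u') v = pure u v + pure u' v.
Proof. exact: (pure_biadditive.1 v). Qed.

Lemma pureDr u v v' : pure u (v + v') = pure u v + pure u v'.
Proof. exact: (pure_biadditive.2 u). Qed.

Lemma tens_ind (P : tens -> Prop) :
  P 0 -> (forall u v x, P x -> P (pure u v + x)) -> forall x, P x.
Proof.
move=> P0 PD x; rewrite -[x]reprK; elim: (repr x) => [|[u v] s IHs] //.
suff -> : \pi_tens ((u, v) :: s) = pure u v + \pi_tens s by apply: PD.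
apply: tens_eqP => G f bf.
by rewrite (tliftD bf) tlift_pure // !tlift_pi // /tsum big_cons.
Qed.

Lemma tens_additive_ext (G : zmodType) (f g : tens -> G) :
  {morph f : x y / x + y} -> {morph g : x y / x + y} ->
  (forall u v, f (pure u v) = g (pure u v)) -> f =1 g.
Proof.
move=> fD gD fg; elim/tens_ind => [|u v x IHx]; last by rewrite fD gD fg IHx.
have f0 : f 0 = 0 by apply: (addrI (f 0)); rewrite -fD !addr0.
have g0 : g 0 = 0 by apply: (addrI (g 0)); rewrite -gD !addr0.
by rewrite f0 g0.
Qed.

End TensorType.

Arguments tens_ind {U V}.

Definition tmap (U V U' V' : zmodType) (f : U -> U') (g : V -> V') :
  tens U V -> tens U' V' := tlift (fun u v => pure (f u) (g v)).

Section TensorRing.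
Variables (R A : pzRingType).
Implicit Types x y z : tens R A.

Definition tens_mul x y : tens R A :=
  tlift (fun r a => tlift (fun s b => pure (r * s) (a * b)) y) x.

Lemma tens_mul_biadd r a :
  biadditive (fun (s : R) (b : A) => pure (r * s) (a * b)).
Proof. by split=> [b s s'|s b b']; rewrite !mulrDr ?(pureDl, pureDr). Qed.

Lemma tens_mul_biadd2 y : biadditive (fun (r : R) (a : A) =>
  tlift (fun s b => pure (r * s) (a * b)) y).
Proof.
split=> [a r r'|r a a']; move: y; apply: tens_additive_ext;
  do ?[by move=> y y'; rewrite !(tliftD (tens_mul_biadd _ _)) // addrACA];
  by move=> s b; rewrite !tlift_pure ?mulrDl ?(pureDl, pureDr) //;
     exact: tens_mul_biadd.
Qed.

Lemma tens_mulDl : left_distributive tens_mul +%R.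
Proof. by move=> x x' y; apply: tliftD (tens_mul_biadd2 y) x x'. Qed.

Lemma tens_mulDr : right_distributive tens_mul +%R.
Proof.
move=> x y y'; move: x; apply: tens_additive_ext => [x x'|x x'|r a].
- exact: tens_mulDl.
- by rewrite !tens_mulDl addrACA.
rewrite /tens_mul !tlift_pure; try exact: tens_mul_biadd2.
by rewrite (tliftD (tens_mul_biadd _ _)).
Qed.

Lemma tens_mul_pure r a s b :
  tens_mul (pure r a) (pure s b) = pure (r * s) (a * b).
Proof.
rewrite /tens_mul tlift_pure; last exact: tens_mul_biadd2.
by rewrite tlift_pure //; exact: tens_mul_biadd.
Qed.

Lemma tens_mulA : associative tens_mul.
Proof.
move=> x y z; move: x; apply: tens_additive_ext => [x x'|x x'|r a].
- by rewrite tens_mulDl.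
- by rewrite !tens_mulDl.
move: y; apply: tens_additive_ext => [y y'|y y'|s b].
- by rewrite tens_mulDl tens_mulDr.
- by rewrite tens_mulDr tens_mulDl.
move: z; apply: tens_additive_ext => [z z'|z z'|t c].
- by rewrite !tens_mulDr.
- by rewrite !tens_mulDr.
by rewrite !tens_mul_pure !mulrA.
Qed.

Lemma tens_mul1l : left_id (pure 1 1) tens_mul.
Proof.
apply: tens_additive_ext => [x y|//|r a]; first exact: tens_mulDr.
by rewrite tens_mul_pure !mul1r.
Qed.

Lemma tens_mul1r : right_id (pure 1 1) tens_mul.
Proof.
apply: tens_additive_ext => [x y|//|r a]; first exact: tens_mulDl.
by rewrite tens_mul_pure !mulr1.
Qed.

HB.instance Definition _ := GRing.Zmodule_isPzRing.Build (tens R A)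
  tens_mulA tens_mul1l tens_mul1r tens_mulDl tens_mulDr.

Lemma pureM r s a b : pure (r * s) (a * b) = pure r a * pure s b :> tens R A.
Proof. by rewrite [RHS]tens_mul_pure. Qed.

End TensorRing.

Section TensorComRing.
Variables (R L : comPzRingType).

Lemma tens_mulC : commutative (@tens_mul R L).
Proof.
move=> x y; move: x; apply: tens_additive_ext => [x x'|x x'|r a].
- exact: tens_mulDl.
- exact: tens_mulDr.
move: y; apply: tens_additive_ext => [y y'|y y'|s b].
- exact: tens_mulDr.
- exact: tens_mulDl.
by rewrite !tens_mul_pure mulrC [a * b]mulrC.
Qed.

HB.instance Definition _ :=
  GRing.PzRing_hasCommutativeMul.Build (tens R L) tens_mulC.

End TensorComRing.

(* R (x) G as an R-algebra, r acting as multiplication by r (x) 1. *)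
Section TensorAlgebra.
Variables (R : comPzRingType) (G : pzRingType).

Definition tens_inl (r : R) : tens R G := pure r 1.

Fact tens_inl_zmod_morphism : zmod_morphism tens_inl.
Proof.
move=> r s; rewrite /tens_inl; apply: (addIr (pure s 1)).
by rewrite subrK -pureDl subrK.
Qed.

Fact tens_inl_monoid_morphism : monoid_morphism tens_inl.
Proof. by split=> // r s; rewrite /tens_inl -pureM mulr1. Qed.

HB.instance Definition _ := GRing.isZmodMorphism.Build R (tens R G) tens_inl
  tens_inl_zmod_morphism.
HB.instance Definition _ := GRing.isMonoidMorphism.Build R (tens R G) tens_inl
  tens_inl_monoid_morphism.

Fact tens_inlC c (x : tens R G) : tens_inl c * x = x * tens_inl c.
Proof.
move: x; apply: tens_additive_ext => [x y|x y|r g].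
- exact: mulrDr.
- exact: mulrDl.
by rewrite /tens_inl -!pureM mulrC mulr1 mul1r.
Qed.

Definition tens_alg : algebra R := Algebra tens_inlC.

End TensorAlgebra.

(* Extension of scalars: for an L-algebra A, the ring R (x) A as an algebra    *)
(* over R (x) L, with (r (x) l) . (s (x) a) = r s (x) l a.                     *)
Section BaseChange.
Variables (R L : comPzRingType) (A : algebra L).

Definition bc_map : tens R L -> tens R A := tmap id (alg_map A).

Fact bc_biadditive :
  biadditive (fun (r : R) (l : L) => pure r (alg_map A l : A)).
Proof. by split=> [l r r'|r l l']; rewrite ?rmorphD ?(pureDl, pureDr). Qed.

Lemma bc_mapE r l : bc_map (pure r l) = pure r (alg_map A l : A).
Proof. by rewrite /bc_map /tmap tlift_pure //; exact: bc_biadditive. Qed.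

Fact bc_mapD : {morph bc_map : x y / x + y}.
Proof. exact: tliftD bc_biadditive. Qed.

Fact bc_zmod_morphism : zmod_morphism bc_map.
Proof.
by move=> x y; apply: (addIr (bc_map y)); rewrite -bc_mapD !subrK.
Qed.

Fact bc_monoid_morphism : monoid_morphism bc_map.
Proof.
split=> [|x y]; first by rewrite bc_mapE rmorph1.
move: x; apply: tens_additive_ext => [x x'|x x'|r a].
- by rewrite mulrDl bc_mapD.
- by rewrite bc_mapD mulrDl.
move: y; apply: tens_additive_ext => [y y'|y y'|s b].
- by rewrite mulrDr bc_mapD.
- by rewrite bc_mapD mulrDr.
by rewrite -pureM !bc_mapE -pureM rmorphM.
Qed.

HB.instance Definition _ := GRing.isZmodMorphism.Build (tens R L) (tens R A)
  bc_map bc_zmod_morphism.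
HB.instance Definition _ := GRing.isMonoidMorphism.Build (tens R L) (tens R A)
  bc_map bc_monoid_morphism.

Fact bc_mapC c (x : tens R A) : bc_map c * x = x * bc_map c.
Proof.
move: c; apply: tens_additive_ext => [c d|c d|s l].
- by rewrite bc_mapD mulrDl.
- by rewrite bc_mapD mulrDr.
move: x; apply: tens_additive_ext => [x y|x y|r a].
- exact: mulrDr.
- exact: mulrDl.
by rewrite bc_mapE -!pureM mulrC alg_mapC.
Qed.

Definition base_change : algebra (tens R L) := Algebra bc_mapC.

End BaseChange.

Local Notation "x %:F" := (tofrac x).

(* Z[v, v^-1], as the subring of Z(v) of the fractions p(v) / v^n. *)
Definition is_laurent : {pred {fraction {poly int}}} :=
  fun x => `[< exists (p : {poly int}) (n : nat), x = p%:F / 'X%:F ^+ n >].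

Fact laurentP x : reflect
  (exists (p : {poly int}) (n : nat), x = p%:F / 'X%:F ^+ n)
  (x \in is_laurent).
Proof. exact: asboolP. Qed.

Fact laurent_subring : subring_closed is_laurent.
Proof.
have X0 n : 'X%:F ^+ n != 0 :> {fraction {poly int}}.
  by rewrite expf_neq0 // tofrac_eq0 polyX_eq0.
split=> [|x y|x y].
- by apply/laurentP; exists 1, 0%N; rewrite expr0 divr1 tofrac1.
- move=> /laurentP[p [m ->]] /laurentP[q [n ->]]; apply/laurentP.
  exists (p * 'X^n - q * 'X^m), (m + n)%N.
  rewrite tofracB !tofracM !tofracXn exprD -mulNr addf_div ?X0 //.
  by rewrite mulNr.
move=> /laurentP[p [m ->]] /laurentP[q [n ->]]; apply/laurentP.
by exists (p * q), (m + n)%N; rewrite tofracM exprD invfM mulrACA.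
Qed.

HB.instance Definition _ :=
  GRing.isSubringClosed.Build {fraction {poly int}} is_laurent laurent_subring.

Record laurent := Laurent {
  laurent_val : {fraction {poly int}};
  laurent_valP : laurent_val \in is_laurent
}.

HB.instance Definition _ := [isSub for laurent_val].
HB.instance Definition _ := [Choice of laurent by <:].
HB.instance Definition _ := [SubChoice_isSubComNzRing of laurent by <:].

Section Bases.
Variables (R : pzRingType) (V : lmodType R).
Implicit Types (B X : set V) (v : V).

Definition lin_comb B (c : {fsfun B -> R with 0}) : V :=
  \sum_(b <- finsupp c) c b *: \val b.

Definition is_basis B : Prop :=
  forall v, exists! c : {fsfun B -> R with 0}, v = lin_comb c.

(* basis_coord B v b is the coefficient of b in v; meaningful when B is a basis. *)
Definition basis_coord B v : {fsfun B -> R with 0} :=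
  xget [fsfun] [set c | v = lin_comb c].

Definition lin_span X : set V :=
  [set v | exists c : {fsfun X -> R with 0}, v = lin_comb c].

End Bases.

Definition anti_involution (R : comPzRingType) (A : algebra R) (f : A -> A) :=
  [/\ linear f, {morph f : x y / x * y >-> y * x} & involutive f].

(* Normalized table algebras over Z; the structure constants are integers, so  *)
(* only their sign has to be constrained.                                      *)
Record table_algebra (G : algebra int) (B : set G) (bar : G -> G) : Prop := {
  table_basis : is_basis B;
  table_one : B 1;
  table_nat : forall b b' b'' : B, 0 <= basis_coord B (\val b * \val b') b'';
  table_bar : anti_involution bar;
  table_bar_basis : bar @` B = B;
  table_adjoint : forall b b' b'' : B,
    basis_coord B (\val b * \val b') b'' = basis_coord B (\val b'' * bar (\val b')) b
}.

Section Tabular.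
Variables (d : Order.disp_t) (Lam : finPOrderType d).
Variables (Gam : Lam -> algebra int) (B : forall l, set (Gam l)).
Arguments B : clear implicits.
Variables (bar : forall l, Gam l -> Gam l) (M : Lam -> finType).
Variable A : algebra laurent.

Definition tab_index := {l : Lam & (M l * B l * M l)%type}.

Variable C : tab_index -> A.

Definition tab_C l (S : M l) (b : B l) (T : M l) : A :=
  C (Tagged (fun l => (M l * B l * M l)%type) (S, b, T)).

(* C_{S,T}^g, for g in Gam l *)
Definition tab_Cg l (S T : M l) (g : Gam l) : A :=
  \sum_(b <- finsupp (basis_coord (B l) g)) tab_C S b T *~ basis_coord (B l) g b.

(* C_{S,T}^g, for g with coefficients in Z[v, v^-1] *)
Definition tab_CgA l (S T : M l) : tens laurent (Gam l) -> A :=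
  tlift (fun c g => c *: tab_Cg S T g).

(* C_{S,T}^g, for g with coefficients in R; an element of R (x) A *)
Definition tab_CgR (R : comPzRingType) l (S T : M l) :
  tens R (Gam l) -> tens R A := tmap id (tab_Cg S T).

Definition tab_lower (l : Lam) : set A :=
  lin_span [set x | exists m (S T : M m) (b : B m), (m < l)%O /\ x = tab_C S b T].

(* In tab_mul, g in Gam l is read in Z[v, v^-1] (x) Gam l as 1 (x) g.          *)
Record tabular (star : A -> A) : Prop := {
  tab_table : forall l, table_algebra (B l) (@bar l);
  tab_inj : injective C;
  tab_basis : is_basis (range C);
  tab_idem : exists E : set A,
    [/\ E `<=` range C,
        forall e, E e -> e * e = e,
        forall e f, E e -> E f -> e <> f -> e * f = 0,
        forall a : A, exists s : seq (A * A * A),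
          (forall p, p \in s -> E p.1.1 /\ E p.2) /\
          a = \sum_(p <- s) p.1.1 * p.1.2 * p.2
      & forall X, range C X -> exists e f, [/\ E e, E f & X = e * X * f]];
  tab_star : anti_involution star;
  tab_star_C : forall l (S T : M l) (b b' : B l),
    \val b' = bar (\val b) -> star (tab_C S b T) = tab_C T b' S;
  tab_mul : forall l (a : A), exists r : M l -> M l -> tens laurent (Gam l),
    forall (S T : M l) (g : Gam l),
      tab_lower l (a * tab_Cg S T g
                   - \sum_(S' : M l) tab_CgA S' T (r S' S * pure 1 g))
}.

End Tabular.

Section Cellular.
Variables (R : comPzRingType) (A : algebra R).
Variables (d : Order.disp_t) (Lam : finPOrderType d) (M : Lam -> finType).

Definition cell_index := {l : Lam & (M l * M l)%type}.

Variable C : cell_index -> A.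

Definition cell_C l (S T : M l) : A :=
  C (Tagged (fun l => (M l * M l)%type) (S, T)).

Definition cell_lower (l : Lam) : set A :=
  lin_span [set x | exists m (S T : M m), (m < l)%O /\ x = cell_C S T].

Record cellular (star : A -> A) : Prop := {
  cell_inj : injective C;
  cell_basis : is_basis (range C);
  cell_star : anti_involution star;
  cell_star_C : forall l (S T : M l), star (cell_C S T) = cell_C T S;
  cell_mul : forall l (a : A), exists r : M l -> M l -> R,
    forall S T : M l,
      cell_lower l (a * cell_C S T - \sum_(S' : M l) r S' S *: cell_C S' T)
}.

End Cellular.

(* {l : Lam & Lamc l} carries the library's lexicographic order on dependent   *)
(* pairs (leEsig, ltEsig).                                                     *)
Section InducedDatum.
Variables (d : Order.disp_t) (Lam : finPOrderType d).
Variables (Gam : Lam -> algebra int) (B : forall l, set (Gam l)).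
Arguments B : clear implicits.
Variables (M : Lam -> finType) (A : algebra laurent) (C : tab_index B M -> A).
Variables (R : comPzRingType) (d' : Order.disp_t).
Variables (Lamc : Lam -> finPOrderType d') (Mc : forall l, Lamc l -> finType).
Variable Cc : forall l, cell_index (@Mc l) -> tens_alg R (Gam l).

Definition induced_M (p : {l : Lam & Lamc l}) : finType :=
  (M (tag p) * Mc (tagged p))%type.

Definition induced_C (x : cell_index induced_M) : base_change R A :=
  let: existT p (Ss, Tt) := x in
  tab_CgR C Ss.1 Tt.1 (cell_C (@Cc (tag p)) Ss.2 Tt.2).

End InducedDatum.

(* Main.v *)
(* R (x) A has the R (x) Z[v,v^-1]-basis 1 (x) C_{S,T}^b, and for fixed l, S, T
   the elements C_{S,T}^{C_l(s,t)} come from these by the change of basis of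
   R (x) Gam l from the 1 (x) b to the C_l(s,t); so they form a basis, which we
   exhibit by spanning and by dual functionals.  Injectivity of C' needs 1 <> 0
   in R (x) Z[v,v^-1], and this is where Z <= R enters, through v |-> 1.
   Modulo the cells below l, an elementary tensor r (x) a turns C_{S,T}^g into
   the sum over S' of C_{S',T}^{r r_a(S',S) g}; the element r r_a(S',S) is a
   sum of c (r (x) h) with c in Z[v,v^-1] and h in Gam l, so the cellular
   multiplication in R (x) Gam l expands each product (r (x) h) C_l(s,t) modulo
   lower l', and the lexicographic order absorbs both kinds of lower terms. *)
Require Import Defs.
From HB Require Import structures.
From mathcomp Require Import all_boot all_order all_algebra.
From mathcomp Require Import finmap.
From mathcomp Require Import boolp classical_sets cardinality.

Set Implicit Arguments.
Unset Strict Implicit.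
Unset Printing Implicit Defensive.

Import Order.TTheory GRing.Theory Num.Theory.

Local Open Scope classical_set_scope.
Local Open Scope ring_scope.

(** * Additive maps *)

Lemma morph_add0 (U V : zmodType) (f : U -> V) :
  {morph f : x y / x + y} -> f 0 = 0.
Proof. by move=> fD; apply: (addrI (f 0)); rewrite -fD !addr0. Qed.

Lemma morph_addN (U V : zmodType) (f : U -> V) :
  {morph f : x y / x + y} -> {morph f : x / - x}.
Proof.
move=> fD x; apply: (addrI (f x)).
by rewrite -fD !subrr (morph_add0 fD).
Qed.

Lemma morph_addB (U V : zmodType) (f : U -> V) :
  {morph f : x y / x + y} -> {morph f : x y / x - y}.
Proof. by move=> fD x y; rewrite fD (morph_addN fD). Qed.

Lemma morph_add_sum (U V : zmodType) (f : U -> V) (I : Type) (s : seq I)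
  (P : pred I) (F : I -> U) : {morph f : x y / x + y} ->
  f (\sum_(i <- s | P i) F i) = \sum_(i <- s | P i) f (F i).
Proof. by move=> fD; apply: big_morph => //; apply: morph_add0. Qed.

Lemma morph_addMz (U V : zmodType) (f : U -> V) (x : U) (n : int) :
  {morph f : x y / x + y} -> f (x *~ n) = f x *~ n.
Proof.
move=> fD; have fMn (m : nat) : f (x *+ m) = f x *+ m.
  by elim: m => [|m IH]; rewrite ?mulr0n ?(morph_add0 fD) // !mulrS fD IH.
by case: n => n; rewrite -?pmulrn ?NegzE ?mulrNz -?pmulrn ?(morph_addN fD) fMn.
Qed.

(** * Linear combinations and spans *)

Section Span.
Variables (R : pzRingType) (V : lmodType R).
Implicit Types (X Y : set V) (u v : V).

(** Zero coefficients contribute nothing, so sums over different supports can be moved to one common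
    finite set before they are compared. *)
Lemma big_finsupp_sub X (W : zmodType) (w : X -> R -> W)
  (c : {fsfun X -> R with 0}) (K : {fset X}) :
  (forall b, w b 0 = 0) -> (finsupp c `<=` K)%fset ->
  \sum_(b <- finsupp c) w b (c b) = \sum_(b <- K) w b (c b).
Proof.
move=> w0 cK; apply: big_fset_incl => // b _ bc.
by rewrite fsfun_dflt.
Qed.

Lemma lin_span0 X : lin_span X 0.
Proof. by exists [fsfun]; rewrite /lin_comb finsupp0 big_seq_fset0. Qed.

(** The witness is described twice: its pointwise values give additivity of coordinates in a basis,
    its [lin_comb] gives closure of spans. *)
Lemma lin_combD X (c c' : {fsfun X -> R with 0}) :
  {e : {fsfun X -> R with 0} | (forall b, e b = c b + c' b) &
    lin_comb e = lin_comb c + lin_comb c'}.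
Proof.
pose K := (finsupp c `|` finsupp c')%fset.
pose e : {fsfun X -> R with 0} := [fsfun b in K => c b + c' b].
have eE b : e b = c b + c' b.
  rewrite fsfunE in_fsetU; case: finsuppP => //= _; case: finsuppP => //= _.
  by rewrite addr0.
exists e => //.
have s0 (b : X) : 0 *: \val b = 0 by rewrite scale0r.
rewrite /lin_comb (big_finsupp_sub (w := fun b a => a *: \val b) (K := K) s0).
  rewrite (big_finsupp_sub (w := fun b a => a *: \val b) (K := K) s0) ?fsubsetUl //.
  rewrite (big_finsupp_sub (w := fun b a => a *: \val b) (K := K) s0) ?fsubsetUr //.
  by rewrite -big_split; apply: eq_bigr => b _; rewrite eE scalerDl.
by apply/fsubsetP => b; rewrite finsupp_fsfun !inE => /andP[].
Qed.

Lemma lin_combZ X (a : R) (c : {fsfun X -> R with 0}) :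
  {e : {fsfun X -> R with 0} | (forall b, e b = a * c b) &
    lin_comb e = a *: lin_comb c}.
Proof.
pose e : {fsfun X -> R with 0} := [fsfun b in finsupp c => a * c b].
have eE b : e b = a * c b.
  by rewrite fsfunE; case: finsuppP => //= _; rewrite mulr0.
exists e => //.
have s0 (b : X) : 0 *: \val b = 0 by rewrite scale0r.
rewrite /lin_comb.
rewrite (big_finsupp_sub (w := fun b a => a *: \val b) (K := finsupp c) s0).
  by rewrite scaler_sumr; apply: eq_bigr => b _; rewrite eE scalerA.
by apply/fsubsetP => b; rewrite finsupp_fsfun !inE => /andP[].
Qed.

Lemma lin_comb1 X (x : X) :
  {e : {fsfun X -> R with 0} | (forall b, e b = (b == x)%:R) &
    lin_comb e = \val x}.
Proof.
pose e : {fsfun X -> R with 0} := [fsfun b in [fset x]%fset => 1].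
have eE b : e b = (b == x)%:R by rewrite fsfunE inE; case: eqP.
exists e => //.
have s0 (b : X) : 0 *: \val b = 0 by rewrite scale0r.
rewrite /lin_comb.
rewrite (big_finsupp_sub (w := fun b a => a *: \val b) (K := [fset x]%fset) s0).
  by rewrite big_seq_fset1 eE eqxx scale1r.
by apply/fsubsetP => b; rewrite finsupp_fsfun !inE => /andP[].
Qed.

Lemma lin_spanD X u v : lin_span X u -> lin_span X v -> lin_span X (u + v).
Proof. by move=> [c ->] [c' ->]; have [e _ <-] := lin_combD c c'; exists e. Qed.

Lemma lin_spanZ X (a : R) v : lin_span X v -> lin_span X (a *: v).
Proof. by move=> [c ->]; have [e _ <-] := lin_combZ a c; exists e. Qed.

Lemma lin_span_gen X v : X v -> lin_span X v.
Proof.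
move=> /mem_set Xv; have [e _ /= <-] := lin_comb1 (SigSub Xv : X).
by exists e.
Qed.

Lemma lin_span_sum X (I : Type) (s : seq I) (P : pred I) (F : I -> V) :
  (forall i, P i -> lin_span X (F i)) -> lin_span X (\sum_(i <- s | P i) F i).
Proof.
move=> XF; elim/big_ind: _ => //; [exact: lin_span0|exact: lin_spanD].
Qed.

(** With the scalar placed on the generator, only additivity of [P] is left to check, which suits
    identities between additive maps. *)
Lemma lin_span_ind X (P : V -> Prop) :
  P 0 -> (forall u v, P u -> P v -> P (u + v)) ->
  (forall a x, X x -> P (a *: x)) -> forall v, lin_span X v -> P v.
Proof.
move=> P0 PD PZ v [c ->]; rewrite /lin_comb; elim/big_ind: _ => // b _.
by apply: PZ; apply: set_mem; apply: valP.
Qed.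

End Span.

(** * Coordinates, and additive maps prescribed on a basis *)

Section Basis.
Variables (R : pzRingType) (V : lmodType R) (B : set V).
Hypothesis hB : is_basis B.

Lemma basis_coordK v : v = lin_comb (basis_coord B v).
Proof.
have [c [vc _]] := hB v.
exact: (@xgetPex _ [fsfun] [set c | v = lin_comb c] (ex_intro _ c vc)).
Qed.

Lemma basis_coord_unique (c : {fsfun B -> R with 0}) :
  basis_coord B (lin_comb c) = c.
Proof.
have [e [_ ue]] := hB (lin_comb c).
by rewrite -[RHS](ue _ (erefl _)) (ue _ (basis_coordK _)).
Qed.

Lemma basis_coordD u v b :
  basis_coord B (u + v) b = basis_coord B u b + basis_coord B v b.
Proof.
have [e eE] := lin_combD (basis_coord B u) (basis_coord B v).
by rewrite -!basis_coordK => <-; rewrite basis_coord_unique eE.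
Qed.

Lemma basis_coordZ a v b : basis_coord B (a *: v) b = a * basis_coord B v b.
Proof.
have [e eE] := lin_combZ a (basis_coord B v).
by rewrite -!basis_coordK => <-; rewrite basis_coord_unique eE.
Qed.

Lemma basis_coord_val (b b' : B) : basis_coord B (\val b) b' = (b' == b)%:R.
Proof. by have [e eE <-] := lin_comb1 b; rewrite basis_coord_unique eE. Qed.

Lemma basis_span v : lin_span B v.
Proof. by exists (basis_coord B v); apply: basis_coordK. Qed.

Variables (W : zmodType) (w : B -> R -> W).

(* The additive map V -> W with a *: b |-> w b a, for w b additive. *)
Definition basis_map (v : V) : W :=
  \sum_(b <- finsupp (basis_coord B v)) w b (basis_coord B v b).

Hypothesis wD : forall b, {morph w b : x y / x + y}.

Lemma basis_mapD : {morph basis_map : u v / u + v}.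
Proof.
have w0 b : w b 0 = 0 by rewrite (morph_add0 (@wD b)).
move=> u v; rewrite /basis_map.
pose K := (finsupp (basis_coord B u) `|` finsupp (basis_coord B v))%fset.
(* The supports of [u], [v] and [u + v] may differ, so all three sums are taken over their union. *)
rewrite (big_finsupp_sub (K := (K `|` finsupp (basis_coord B (u + v)))%fset)) //;
  last by rewrite fsubsetUr.
rewrite (big_finsupp_sub (K := (K `|` finsupp (basis_coord B (u + v)))%fset) w0);
  last by rewrite -fsetUA fsubsetUl.
rewrite (big_finsupp_sub (K := (K `|` finsupp (basis_coord B (u + v)))%fset) w0);
  last by rewrite /K fsetUAC fsubsetUr.
by rewrite -big_split; apply: eq_bigr => b _; rewrite basis_coordD wD.
Qed.

Lemma basis_map_val a (b : B) : basis_map (a *: \val b) = w b a.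
Proof.
have w0 c : w c 0 = 0 by rewrite (morph_add0 (@wD c)).
rewrite /basis_map (big_finsupp_sub (K := [fset b]%fset)) //.
  by rewrite big_seq_fset1 basis_coordZ basis_coord_val eqxx mulr1.
apply/fsubsetP => c; rewrite mem_finsupp basis_coordZ basis_coord_val inE.
by case: (c =P b) => // _; rewrite mulr0 eqxx.
Qed.

End Basis.

(** * Indexed bases and dual functionals *)

Section IndexedBasis.
Variables (R : pzRingType) (V : lmodType R).

(** The functional dual to [i] is 1 at [e i] and 0 at every other [e j], so a coincidence would
    force 1 = 0. *)
Lemma dual_family_inj (I : eqType) (e : I -> V) :
  (1 : R) != 0 ->
  (forall i, exists f : V -> R, forall j, f (e j) = (i == j)%:R) ->
  injective e.
Proof.
move=> R1 dual i j eij; have [f fE] := dual i.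
apply/eqP; move: R1; apply: contraNT => /negPf ij.
by rewrite -[1]/(true%:R : R) -(eqxx i) -fE eij fE ij.
Qed.

(** The functional dual to [i] reads off the coefficient of [e i] from any linear combination,
    whence uniqueness; spanning gives existence. *)
Lemma is_basis_dual_family (I : eqType) (e : I -> V) :
  (forall v, lin_span (range e) v) ->
  (forall i, exists f : V -> R, [/\ {morph f : x y / x + y},
     (forall a v, f (a *: v) = a * f v) & forall j, f (e j) = (i == j)%:R]) ->
  injective e -> is_basis (range e).
Proof.
move=> spanV dual inj_e v; have [c vc] := spanV v; exists c; split=> // c' vc'.
apply/fsfunP => b; have [i _ ib] := set_mem (valP b).
have [f [fD fZ fE]] := dual i.
suff coord (a : {fsfun range e -> R with 0}) : f (lin_comb a) = a b.
  by rewrite -!coord -vc -vc'.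
rewrite /lin_comb (morph_add_sum _ _ _ fD).
have fval (b' : range e) : f (\val b') = (b' == b)%:R.
  have [j _ jb] := set_mem (valP b').
  by rewrite -jb fE -val_eqE -jb /= -ib (inj_eq inj_e) eq_sym.
rewrite (eq_bigr (fun b' => if b' == b then a b else 0)) => [|b' _]; last first.
  by rewrite fZ fval; case: eqP => [->|_]; rewrite ?mulr1 ?mulr0.
have [ba|ba] := finsuppP a b; last first.
  rewrite (big_fsetD1 b) //= eqxx big1_fset ?addr0 // => b'.
  by rewrite !inE => /andP[/negPf ->].
by rewrite big_seq big1 // => b' b'a; case: eqP => // b'b; rewrite -b'b b'a in ba.
Qed.

(** [u] recovers the index of a basis element. Exposing it lets [base_change_functional] use one [u]
    for a whole family of maps. *)
Lemma basis_family_map (I : Type) (e : I -> V) (he : is_basis (range e))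
  (inj_e : injective e) (W : zmodType) (w : I -> R -> W) :
  (forall i, {morph w i : x y / x + y}) ->
  exists u : range e -> I, forall i a,
    basis_map (fun b => w (u b)) (a *: e i) = w i a.
Proof.
move=> wD; pose u (b : range e) := s2val (cid2 (set_mem (valP b))).
exists u => i a; have ei : e i \in range e by apply/mem_set; exists i.
rewrite -[e i]/(\val (SigSub ei : range e)) basis_map_val //.
by congr (w _ a); apply: inj_e; rewrite /u; case: cid2.
Qed.

Lemma basis_family_dual (I : eqType) (e : I -> V) :
  is_basis (range e) -> injective e -> forall i,
  exists f : V -> R, [/\ {morph f : x y / x + y},
    (forall a v, f (a *: v) = a * f v) & forall j, f (e j) = (i == j)%:R].
Proof.
move=> he inj_e i; have ei : e i \in range e by apply/mem_set; exists i.
pose b : range e := SigSub ei.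
exists (fun v => basis_coord (range e) v b); split.
- by move=> x y; apply: basis_coordD.
- by move=> a v; apply: basis_coordZ.
move=> j; have ej : e j \in range e by apply/mem_set; exists j.
rewrite -[e j]/(\val (SigSub ej : range e)) basis_coord_val //.
by rewrite -val_eqE /= (inj_eq inj_e).
Qed.

End IndexedBasis.

(** * Functionals and generators for extended scalars *)

Lemma base_change_scale_pure (R L : comPzRingType) (A : algebra L) r l s (a : A) :
  (pure r l : tens R L) *: (pure s a : base_change R A) = pure (r * s) (l *: a).
Proof. by rewrite alg_scaleE /= bc_mapE -pureM. Qed.

Lemma tens_alg_scale_pure (R : comPzRingType) (G : algebra int) r s (g : G) :
  r *: (pure s g : tens_alg R G) = pure (r * s) g.
Proof. by rewrite alg_scaleE /= /tens_inl -pureM mul1r. Qed.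

(** Send r (x) a, with a the sum of the l_i e_i, to the sum of the (r (x) l_i) w_i. This is
    biadditive in r and a and linear over [tens R L], so the values at the 1 (x) e_i can be
    prescribed at will. *)
Lemma base_change_functional (R L : comPzRingType) (A : algebra L)
  (I : Type) (e : I -> A) (w : I -> tens R L) :
  is_basis (range e) -> injective e ->
  exists F : base_change R A -> tens R L, [/\ {morph F : x y / x + y},
    (forall c x, F (c *: x) = c * F x) & forall i, F (pure 1 (e i)) = w i].
Proof.
move=> he inj_e.
have wD r i : {morph (fun l : L => pure r l * w i) : x y / x + y}.
  by move=> x y; rewrite pureDr mulrDl.
have [u uE] := basis_family_map he inj_e (wD 1).
pose f (r : R) (a : A) := basis_map (fun b l => pure r l * w (u b)) a.
have fD r : {morph f r : x y / x + y} by apply: basis_mapD => // b; apply: wD.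
have f_biadd : biadditive f.
  split=> [a r s|r]; last exact: fD.
  by rewrite /f /basis_map -big_split; apply: eq_bigr => b _; rewrite pureDl mulrDl.
have fZ r s l a : f (r * s) (l *: a) = pure r l * f s a.
  move: (basis_span he a).
  apply: (lin_span_ind (P := fun a => f (r * s) (l *: a) = pure r l * f s a)).
  - by rewrite scaler0 !(morph_add0 (fD _)) mulr0.
  - by move=> x y IHx IHy; rewrite scalerDr !fD IHx IHy mulrDr.
  move=> c x /mem_set xe; rewrite scalerA -[x]/(\val (SigSub xe : range e)).
  rewrite /f !basis_map_val //; try by move=> b; apply: wD.
  by rewrite mulrA -pureM.
exists (tlift f); split.
- exact: tliftD.
- move=> c x; move: c; apply: tens_additive_ext => [c d|c d|r l].
  + by rewrite scalerDl tliftD.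
  + by rewrite mulrDl.
  move: x; apply: tens_additive_ext => [x y|x y|s a].
  + by rewrite scalerDr tliftD.
  + by rewrite tliftD // mulrDr.
  by rewrite base_change_scale_pure !tlift_pure.
move=> i; rewrite tlift_pure // -[e i]scale1r /f uE.
exact: mul1r.
Qed.

Lemma tens_alg_span (R : comPzRingType) (G : algebra int) (B : set G) :
  is_basis B -> forall x : tens_alg R G,
  lin_span ((fun b : G => pure 1 b : tens_alg R G) @` B) x.
Proof.
move=> hB; apply: tens_ind; first exact: lin_span0.
move=> r g x Bx; apply: (lin_spanD _ Bx) => {x Bx}.
have pD : {morph (@pure R G r) : x y / x + y} by move=> u v; apply: pureDr.
have pDl (b : G) : {morph (fun s : R => pure s b) : x y / x + y}.
  by move=> u v; apply: pureDl.
move: (basis_span hB g); apply: (lin_span_ind (P := fun g : G =>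
  lin_span ((fun b : G => pure 1 b : tens_alg R G) @` B) (pure r g))).
- by rewrite (morph_add0 pD); apply: lin_span0.
- by move=> u v Bu Bv; rewrite pD; apply: lin_spanD.
move=> z b Bb.
(* The integer [z] moves across the tensor sign. *)
have -> : pure r (z *: b) = (r *~ z) *: (pure 1 b : tens_alg R G).
  rewrite tens_alg_scale_pure mulr1 (morph_addMz _ _ (pDl b)).
  by rewrite -(morph_addMz _ _ pD) -scaler_int intz.
by apply/lin_spanZ/lin_span_gen; exists b.
Qed.

(** * Nontriviality of R (x) Z[v,v^-1] *)

Section EvalOne.
Local Notation "x %:F" := (tofrac x).

(** Evaluation at v = 1 sends p / X^n to p(1). The value does not depend on the presentation: p /
    X^m = q / X^n means p X^n = q X^m, and evaluating at 1 gives p(1) = q(1). *)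
Lemma laurent_eval1 :
  exists f : laurent -> int, {morph f : x y / x + y} /\ f 1 = 1.
Proof.
have X0 n : 'X%:F ^+ n != 0 :> {fraction {poly int}}.
  by rewrite expf_neq0 // tofrac_eq0 polyX_eq0.
pose P (x : laurent) (p : {poly int}) :=
  exists n, laurent_val x = p%:F / 'X%:F ^+ n.
have Pex x : {p | P x p} by apply: cid; apply/laurentP/laurent_valP.
have Puniq x p q : P x p -> P x q -> p.[1] = q.[1].
  move=> [m px] [n]; rewrite px => /eqP; rewrite eqr_div ?X0 // -!tofracXn -!tofracM.
  rewrite tofrac_eq => /eqP /(congr1 (horner^~ 1)).
  by rewrite !hornerM !hornerXn !expr1n !mulr1.
exists (fun x => (sval (Pex x)).[1]); split=> [x y|].
  case: (Pex x) (Pex y) (Pex (x + y)) => [p [m px]] [q [n py]] [s ps] /=.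
  have -> : s.[1] = (p * 'X^n + q * 'X^m).[1].
    apply: (Puniq _ _ _ ps); exists (m + n)%N.
    rewrite [laurent_val _](_ : _ = laurent_val x + laurent_val y) // px py.
    by rewrite tofracD !tofracM !tofracXn exprD addf_div ?X0.
  by rewrite hornerD !hornerM !hornerXn !expr1n !mulr1.
rewrite -[1 in RHS](hornerC 1 1); apply: (Puniq 1 _ 1); first exact: svalP.
by exists 0%N; rewrite expr0 divr1 tofrac1.
Qed.

End EvalOne.

(** The biadditive map (r, l) |-> r l(1) sends 1 (x) 1 to 1, which is nonzero in R because the
    integers embed there. *)
Lemma tens_laurent_nontrivial (R : comPzRingType) :
  injective (fun n : int => n%:~R : R) -> (1 : tens R laurent) != 0.
Proof.
move=> hR; have [f [fD f1]] := laurent_eval1.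
pose g (r : R) (l : laurent) := r * (f l)%:~R.
have bg : biadditive g.
  by split=> [l r s|r l m]; rewrite /g ?mulrDl // fD rmorphD mulrDr.
apply/eqP => /(congr1 (tlift g)).
rewrite -[1]/(pure 1 1) tlift_pure // tlift0 // /g f1 mul1r => /(hR 1 0).
by [].
Qed.

(** * Functoriality of the tensor product and the extended involution *)

Lemma tmap_biadditive (U V U' V' : zmodType) (f : U -> U') (g : V -> V') :
  {morph f : x y / x + y} -> {morph g : x y / x + y} ->
  biadditive (fun u v => pure (f u) (g v)).
Proof.
by move=> fD gD; split=> [v x y|u x y]; rewrite ?fD ?gD ?pureDl ?pureDr.
Qed.

Lemma tmapD (U V U' V' : zmodType) (f : U -> U') (g : V -> V') :
  {morph f : x y / x + y} -> {morph g : x y / x + y} ->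
  {morph tmap f g : x y / x + y}.
Proof. by move=> fD gD; apply/tliftD/tmap_biadditive. Qed.

Lemma tmap_pure (U V U' V' : zmodType) (f : U -> U') (g : V -> V') u v :
  {morph f : x y / x + y} -> {morph g : x y / x + y} ->
  tmap f g (pure u v) = pure (f u) (g v).
Proof. by move=> fD gD; rewrite /tmap tlift_pure //; apply: tmap_biadditive. Qed.

Lemma base_change_anti_involution (R L : comPzRingType) (A : algebra L)
  (star : A -> A) :
  anti_involution star ->
  @anti_involution _ (base_change R A) (tmap id star).
Proof.
move=> [starL starM starK].
have idD : {morph @id R : x y / x + y} by [].
have starD : {morph star : x y / x + y}.
  by move=> x y; have := starL 1 x y; rewrite !scale1r.
have starZ c x : star (c *: x) = c *: star x.
  by have := starL c x 0; rewrite !addr0 (morph_add0 starD) addr0.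
have TD := tmapD idD starD.
have TP r a : tmap id star (pure r a) = pure r (star a) by apply: tmap_pure.
split.
- move=> c x y; rewrite [LHS]TD; congr (_ + _) => {y}.
  move: c; apply: tens_additive_ext => [c d|c d|r l].
  + by rewrite scalerDl [LHS]TD.
  + by rewrite scalerDl.
  move: x; apply: tens_additive_ext => [x y|x y|s a].
  + by rewrite scalerDr [LHS]TD.
  + by rewrite (TD x y) scalerDr.
  by rewrite base_change_scale_pure !TP starZ base_change_scale_pure.
- move=> x y; move: x; apply: tens_additive_ext => [x x'|x x'|r a].
  + by rewrite mulrDl [LHS]TD.
  + by rewrite (TD x x') mulrDr.
  move: y; apply: tens_additive_ext => [y y'|y y'|s b].
  + by rewrite mulrDr [LHS]TD.
  + by rewrite (TD y y') mulrDl.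
  (* Commutativity of R absorbs the reversal of the product in the first factor. *)
  by rewrite -pureM !TP starM mulrC pureM.
apply: tens_additive_ext => [x y|//|r a]; first by rewrite !TD.
by rewrite !TP starK.
Qed.

(** * The elements C_{S,T}^g with extended coefficients *)

Section TabularElements.
Variables (d : Order.disp_t) (Lam : finPOrderType d).
Variables (Gam : Lam -> algebra int) (B : forall l : Lam, set (Gam l)).
Arguments B : clear implicits.
Variables (bar : forall l : Lam, Gam l -> Gam l) (M : Lam -> finType).
Variables (A : algebra laurent) (C : tab_index B M -> A) (star : A -> A).
Hypothesis hA : tabular bar C star.
Variable R : comPzRingType.

Let hB l : is_basis (B l). Proof. by case: (tab_table hA l). Qed.

(** [tab_Cg] unfolds to [basis_map] with weights (b, z) |-> z C_{S,T}^b. *)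
Lemma tab_CgD l (S T : M l) : {morph tab_Cg C S T : x y / x + y}.
Proof.
apply: (basis_mapD (@hB l) (w := fun b z => tab_C C S b T *~ z)).
by move=> b x y; rewrite mulrzDr.
Qed.

Lemma tab_Cg_val l (S T : M l) (b : B l) :
  tab_Cg C S T (\val b) = tab_C C S b T.
Proof.
rewrite -[\val b]scale1r.
rewrite [LHS](basis_map_val (@hB l) (w := fun b z => tab_C C S b T *~ z)) //.
by move=> c x y; rewrite mulrzDr.
Qed.

Let idD : {morph @id R : x y / x + y}. Proof. by []. Qed.

Lemma tab_CgRD l (S T : M l) : {morph @tab_CgR _ _ _ _ _ _ C R l S T : x y / x + y}.
Proof. by apply: tmapD => //; apply: tab_CgD. Qed.

Lemma tab_CgR_pure l (S T : M l) (r : R) g :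
  tab_CgR C S T (pure r g) = pure r (tab_Cg C S T g).
Proof. by apply: tmap_pure => //; apply: tab_CgD. Qed.

Lemma tab_CgRZ l (S T : M l) (r : R) (x : tens_alg R (Gam l)) :
  tab_CgR C S T (r *: x) = pure r 1 *: (tab_CgR C S T x : base_change R A).
Proof.
move: x; apply: tens_additive_ext => [x y|x y|s g].
- by rewrite scalerDr [LHS]tab_CgRD.
- by rewrite (tab_CgRD S T x y) scalerDr.
by rewrite tens_alg_scale_pure !tab_CgR_pure base_change_scale_pure scale1r.
Qed.

Lemma tab_CgA_biadditive l (S T : M l) :
  biadditive (fun (c : laurent) (g : Gam l) => c *: tab_Cg C S T g).
Proof. by split=> [g x y|c x y]; rewrite ?scalerDl ?tab_CgD ?scalerDr. Qed.

Lemma tab_CgAD l (S T : M l) : {morph tab_CgA C S T : x y / x + y}.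
Proof. exact/tliftD/tab_CgA_biadditive. Qed.

Lemma tab_CgA_pure l (S T : M l) c g :
  tab_CgA C S T (pure c g) = c *: tab_Cg C S T g.
Proof. exact/tlift_pure/tab_CgA_biadditive. Qed.

(** Both sides are additive in [x], and on r (x) g additive in [g], so [tab_star_C] on basis
    elements suffices. *)
Lemma star_tab_CgR l (S T : M l) (x : tens R (Gam l)) :
  tmap id star (tab_CgR C S T x) = tab_CgR C T S (tmap id (@bar l) x).
Proof.
have [_ _ _ [barL barM barK] barB _] := tab_table hA l.
have [starL starM starK] := tab_star hA.
have starD : {morph star : x y / x + y}.
  by move=> u v; have := starL 1 u v; rewrite !scale1r.
have barD : {morph @bar l : x y / x + y}.
  by move=> u v; have := barL 1 u v; rewrite !scale1r.
move: x; apply: tens_additive_ext => [x y|x y|r g].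
- by rewrite tab_CgRD tmapD.
- by rewrite tmapD // tab_CgRD.
rewrite tmap_pure // !tab_CgR_pure tmap_pure //; congr pure.
move: (basis_span (@hB l) g).
apply: (lin_span_ind (P := fun g =>
  star (tab_Cg C S T g) = tab_Cg C T S (bar g))).
- by rewrite (morph_add0 barD) !(morph_add0 (@tab_CgD _ _ _)) (morph_add0 starD).
- by move=> u v IHu IHv; rewrite tab_CgD starD barD tab_CgD IHu IHv.
move=> z b Bb.
have zE (y : Gam l) : z *: y = y *~ z.
  by rewrite -scaler_int intz.
rewrite zE !(morph_addMz _ _ (@tab_CgD _ _ _)) (morph_addMz _ _ starD).
rewrite (morph_addMz _ _ barD) (morph_addMz _ _ (@tab_CgD _ _ _)).
congr (_ *~ _).
(* [tab_star_C] needs [bar b] as an index, which the stability of [B l] under [bar] provides. *)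
have Bb' : bar b \in B l by apply/mem_set; rewrite -barB; exists b.
rewrite -[b]/(\val (SigSub (mem_set Bb) : B l)) tab_Cg_val.
by rewrite (tab_star_C hA S T (b' := SigSub Bb')) // -tab_Cg_val.
Qed.

End TabularElements.

(** * Indices of the induced datum *)

Section InducedCellDatum.
Variables (d : Order.disp_t) (Lam : finPOrderType d).
Variables (Gam : Lam -> algebra int) (B : forall l : Lam, set (Gam l)).
Arguments B : clear implicits.
Variables (bar : forall l : Lam, Gam l -> Gam l) (M : Lam -> finType).
Variables (A : algebra laurent) (C : tab_index B M -> A) (star : A -> A).
Hypothesis hA : tabular bar C star.
Variables (R : comPzRingType) (d' : Order.disp_t).
Variables (Lamc : Lam -> finPOrderType d').
Variables (Mc : forall l : Lam, Lamc l -> finType).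
Variable Cc : forall l : Lam, cell_index (@Mc l) -> tens_alg R (Gam l).
Arguments Cc : clear implicits.
Hypothesis hC : forall l : Lam, cellular (Cc l) (tmap id (@bar l)).

Let C' := induced_C C Cc.

Let hB l : is_basis (B l). Proof. by case: (tab_table hA l). Qed.

Lemma induced_CE l (S T : M l) (l' : Lamc l) (s t : Mc l') :
  cell_C C' (l := Tagged Lamc l') (S, s) (T, t) =
  tab_CgR C S T (cell_C (Cc l) s t).
Proof. by []. Qed.

Definition induced_index l (S T : M l) (l' : Lamc l) (s t : Mc l') :
    cell_index (induced_M M Mc) :=
  existT (fun p => induced_M M Mc p * induced_M M Mc p)%type
    (Tagged Lamc l') ((S, s), (T, t)).

(** The cell indices may lie over different [l'], so they are compared as tagged pairs. The map
    [phi] regroups an index into (S, T) and a cell index, which splits the dependent equality into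
    components. *)
Lemma induced_index_eq l (S S0 T T0 : M l) (l' l0' : Lamc l)
  (s : Mc l') (s0 : Mc l0') (t : Mc l') (t0 : Mc l0') :
  (induced_index S T s t == induced_index S0 T0 s0 t0) =
  (S == S0) && (T == T0) &&
  (Tagged (fun l' => Mc l' * Mc l')%type (s, t) ==
   Tagged (fun l' => Mc l' * Mc l')%type (s0, t0)).
Proof.
pose phi (j : cell_index (induced_M M Mc)) :=
  Tagged (fun l => M l * M l * cell_index (@Mc l))%type
    ((tagged j).1.1, (tagged j).2.1,
     Tagged (fun l' => Mc l' * Mc l')%type ((tagged j).1.2, (tagged j).2.2)).
apply/eqP/idP => [/(congr1 phi)/eqP|].
  by rewrite eq_Tagged /= !xpair_eqE.
move=> /andP[/andP[/eqP-> /eqP->] /eqP].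
exact: (congr1 (fun p => induced_index S0 T0 (tagged p).1 (tagged p).2)).
Qed.

(** * The induced basis *)

(** The C_l(s,t) span R (x) Gam l. The set [X] is arbitrary because it will be both [range C'] and
    the set of cell elements below a given one. *)
Lemma tab_CgR_span l (S T : M l) (X : set (base_change R A)) :
  (forall (l' : Lamc l) (s t : Mc l'), X (tab_CgR C S T (cell_C (Cc l) s t))) ->
  forall x, lin_span X (tab_CgR C S T x).
Proof.
move=> hX x; move: (basis_span (cell_basis (hC l)) x).
apply: (lin_span_ind (P := fun x : tens_alg R (Gam l) =>
  lin_span X (tab_CgR C S T x))).
- by rewrite (morph_add0 (tab_CgRD hA S T)); apply: lin_span0.
- by move=> u v Xu Xv; rewrite (tab_CgRD hA); apply: lin_spanD.
move=> r y [[l' [s t]] _ <-]; rewrite (tab_CgRZ hA).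
by apply: lin_spanZ; apply: lin_span_gen; apply: hX.
Qed.

Lemma pure_tab_C l (S T : M l) (b : B l) (r : R) (c : laurent) :
  pure r (c *: tab_C C S b T) =
  pure r c *: (tab_CgR C S T (pure 1 (\val b)) : base_change R A).
Proof.
by rewrite (tab_CgR_pure hA) (tab_Cg_val hA) base_change_scale_pure mulr1.
Qed.

Lemma induced_span (x : base_change R A) : lin_span (range C') x.
Proof.
move: x; apply: tens_ind; first exact: lin_span0.
move=> r a x Xx; apply: (lin_spanD _ Xx) => {x Xx}.
have pD : {morph (@pure R A r) : x y / x + y} by move=> u v; apply: pureDr.
move: (basis_span (tab_basis hA) a).
apply: (lin_span_ind (P := fun a => lin_span (range C') (pure r a))).
- by rewrite (morph_add0 pD); apply: lin_span0.
- by move=> u v Xu Xv; rewrite pD; apply: lin_spanD.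
move=> c y [[l [[S b] T]] _ <-]; rewrite [pure r _]pure_tab_C.
apply: lin_spanZ; apply: tab_CgR_span => l' s t.
by exists (induced_index S T s t).
Qed.

(** Both sides are semilinear along r |-> r (x) 1, and the 1 (x) b span R (x) Gam l. This evaluates
    a functional prescribed on the 1 (x) C_{S,T}^b at the new elements. *)
Lemma functional_tab_CgR l (S T : M l) (F : base_change R A -> tens R laurent)
  (H : tens_alg R (Gam l) -> tens R laurent) :
  {morph F : x y / x + y} -> (forall a v, F (a *: v) = a * F v) ->
  {morph H : x y / x + y} -> (forall r x, H (r *: x) = pure r 1 * H x) ->
  (forall b : B l, F (pure 1 (tab_C C S b T)) = H (pure 1 (\val b))) ->
  forall x, F (tab_CgR C S T x) = H x.
Proof.
move=> FD FZ HD HZ FH x; move: (tens_alg_span (@hB l) x).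
apply: (lin_span_ind (P := fun x : tens_alg R (Gam l) =>
  F (tab_CgR C S T x) = H x)).
- by rewrite (morph_add0 (tab_CgRD hA S T)) (morph_add0 FD) (morph_add0 HD).
- by move=> u v IHu IHv; rewrite (tab_CgRD hA) FD HD IHu IHv.
move=> r y [b Bb <-]; rewrite (tab_CgRZ hA) FZ HZ (tab_CgR_pure hA).
rewrite -[b]/(\val (SigSub (mem_set Bb) : B l)) (tab_Cg_val hA).
by rewrite FH.
Qed.

(* The functional dual to C'((S,s),(T,t)) sends 1 (x) C_{S,T}^b to the         *)
(* coefficient of C(s,t) in 1 (x) b, and every other 1 (x) C_{S0,T0}^b0 to 0.  *)
Lemma induced_dual (i : cell_index (induced_M M Mc)) :
  exists f : base_change R A -> tens R laurent,
    [/\ {morph f : x y / x + y}, (forall a v, f (a *: v) = a * f v) &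
        forall j, f (C' j) = (i == j)%:R].
Proof.
case: i => -[l l'] [[/= S s] [/= T t]].
have [g [gD gZ gE]] := basis_family_dual (cell_basis (hC l))
  (@cell_inj _ _ _ _ _ _ _ (hC l)) (Tagged (fun l' : Lamc l => Mc l' * Mc l')%type (s, t)).
have g1D : {morph (fun x : tens_alg R (Gam l) => pure (g x) 1 : tens R laurent) :
  x y / x + y} by move=> x y; rewrite gD pureDl.
(* [untag] gives the default 0 over every other element of [Lam]; over [l] the outer indices still
   have to match [S] and [T]. *)
pose w := @untag Lam (fun l => M l * B l * M l)%type _ (0 : tens R laurent) l
  (fun u => if (S == u.1.1) && (T == u.2) then pure (g (pure 1 (\val u.1.2))) 1 else 0).
have [F [FD FZ FE]] := base_change_functional w (tab_basis hA)
  (@tab_inj _ _ _ _ _ _ _ _ _ hA).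
exists F; split=> // -[[l0 l0'] [[/= S0 s0] [/= T0 t0]]].
transitivity (F (tab_CgR C S0 T0 (cell_C (Cc l0) s0 t0))); first by [].
have [ll0|nll0] := eqVneq l l0; last first.
  rewrite (functional_tab_CgR FD FZ (H := fun=> 0)).
  - case: eqP => // /(congr1 (fun j => tag (tag j))) /= e.
    by rewrite e eqxx in nll0.
  - by move=> x y; rewrite addr0.
  - by move=> r x; rewrite mulr0.
  by move=> b; rewrite FE /w untag_dflt //= eq_sym.
subst l0.
rewrite (functional_tab_CgR FD FZ (H := fun x =>
  if (S == S0) && (T == T0) then pure (g x) 1 else 0)).
- have -> := induced_index_eq S S0 T T0 s s0 t t0.
  rewrite gE; case: (_ && _) => //=.
  case: (_ == _) => //=.
  by rewrite (morph_add0 (f := fun r : R => pure r 1)) // => u v; rewrite pureDl.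
- by move=> x y; case: ifP; rewrite ?addr0 // => _; apply: g1D.
- move=> r x; case: ifP; rewrite ?mulr0 // => _.
  by rewrite gZ -pureM mulr1.
by move=> b; rewrite FE /w untagE.
Qed.


Lemma induced_inj : injective (fun n : int => n%:~R : R) -> injective C'.
Proof.
move=> hR; apply: dual_family_inj; first exact: tens_laurent_nontrivial.
by move=> i; have [f [_ _ fE]] := induced_dual i; exists f.
Qed.

Lemma induced_basis :
  injective (fun n : int => n%:~R : R) -> is_basis (range C').
Proof.
move=> hR; apply: is_basis_dual_family; [exact: induced_span| |].
  exact: induced_dual.
exact: induced_inj.
Qed.

(** * Lower cells and multiplication *)

(** A strict drop in the first coordinate puts (m, m') below (l, l') whatever m' is: the second
    coordinates are compared only when l <= m. *)
Lemma cell_lower_tag l (l' : Lamc l) m (S T : M m) x :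
  (m < l)%O -> cell_lower C' (Tagged Lamc l') (tab_CgR C S T x).
Proof.
move=> ml; apply: tab_CgR_span => m' s t.
exists (Tagged Lamc m'), (S, s), (T, t); split=> //.
by rewrite Order.SigmaOrder.ltEsig /= ltW //= (lt_geF ml).
Qed.

(** Here the first coordinates tie and the second decides. *)
Lemma cell_lower_tagged l (l' : Lamc l) (S T : M l) x :
  cell_lower (Cc l) l' x ->
  cell_lower C' (Tagged Lamc l') (tab_CgR C S T x).
Proof.
apply: (lin_span_ind (P := fun x : tens_alg R (Gam l) =>
  cell_lower C' (Tagged Lamc l') (tab_CgR C S T x))).
- by rewrite (morph_add0 (tab_CgRD hA S T)); apply: lin_span0.
- by move=> u v Lu Lv; rewrite (tab_CgRD hA); apply: lin_spanD.
move=> r y [m' [s [t [ml' ->]]]]; rewrite (tab_CgRZ hA).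
apply/lin_spanZ/lin_span_gen.
exists (Tagged Lamc m'), (S, s), (T, t); split=> //.
by rewrite Order.SigmaOrder.ltEsig /= lexx /= tagged_asE.
Qed.

Lemma cell_lower_pure l (l' : Lamc l) r a :
  tab_lower C l a -> cell_lower C' (Tagged Lamc l') (pure r a).
Proof.
have pD : {morph (@pure R A r) : x y / x + y} by move=> u v; apply: pureDr.
apply: (lin_span_ind (P := fun a =>
  cell_lower C' (Tagged Lamc l') (pure r a))).
- by rewrite (morph_add0 pD); apply: lin_span0.
- by move=> u v Lu Lv; rewrite pD; apply: lin_spanD.
move=> c _ [m [S [T [b [ml ->]]]]]; rewrite pure_tab_C.
by apply: lin_spanZ; apply: cell_lower_tag.
Qed.

(* tmap id (tab_CgA C S T) h is C_{S,T}^h for h in R (x) Z[v,v^-1] (x) Gam l. *)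
Lemma cell_mul_tens l (l' : Lamc l) (r : R) (rho : tens laurent (Gam l)) :
  exists q : Mc l' -> Mc l' -> tens R laurent,
  forall (S T : M l) (s t : Mc l'),
    cell_lower C' (Tagged Lamc l')
      (tmap id (tab_CgA C S T)
         (pure r rho * tmap id (pure 1) (cell_C (Cc l) s t))
       - \sum_(s' : Mc l') (q s' s *:
             (tab_CgR C S T (cell_C (Cc l) s' t) : base_change R A))).
Proof.
have pD : {morph (@pure laurent (Gam l) 1) : x y / x + y}.
  by move=> u v; apply: pureDr.
have prD : {morph (@pure R (tens laurent (Gam l)) r) : x y / x + y}.
  by move=> u v; apply: pureDr.
have idD : {morph @id R : x y / x + y} by [].
have ED (S T : M l) := tmapD idD (tab_CgAD hA S T).
move: rho; apply: tens_ind => [|c g rho [q hq]].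
  exists (fun _ _ => 0) => S T s t.
  rewrite (morph_add0 prD) mul0r (morph_add0 (ED S T)) big1.
    by rewrite subr0; apply: lin_span0.
  by move=> s' _; rewrite scale0r.
(* For the summand c (x) g of [rho], cellular multiplication by r (x) g yields coefficients in R;
   tensoring them with c gives the contribution to [q]. *)
have [q0 hq0] := cell_mul (hC l) l' (pure r g).
exists (fun s' s => pure (q0 s' s) c + q s' s) => S T s t.
rewrite prD mulrDl ED.
under eq_bigr do rewrite scalerDl.
rewrite big_split opprD addrACA /=.
apply: lin_spanD (hq S T s t) => {q hq}.
(* The Laurent factor c comes out as the scalar 1 (x) c, leaving a product inside R (x) Gam l. *)
have EE x : tmap id (tab_CgA C S T) (pure r (pure c g) * tmap id (pure 1) x) =
    pure 1 c *: (tab_CgR C S T (pure r g * x) : base_change R A).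
  move: x; apply: tens_additive_ext => [x y|x y|r' g'].
  - by rewrite (tmapD idD pD) mulrDr ED.
  - by rewrite mulrDr (tab_CgRD hA) scalerDr.
  rewrite (tmap_pure _ _ idD pD) -!pureM.
  rewrite (tmap_pure _ _ idD (tab_CgAD hA S T)) (tab_CgA_pure hA) (tab_CgR_pure hA).
  by rewrite base_change_scale_pure mul1r mulr1.
have -> : \sum_(s' : Mc l') pure (q0 s' s) c *:
      (tab_CgR C S T (cell_C (Cc l) s' t) : base_change R A) =
    pure 1 c *: (tab_CgR C S T (\sum_(s' : Mc l') q0 s' s *: cell_C (Cc l) s' t)
                 : base_change R A).
  rewrite (morph_add_sum _ _ _ (tab_CgRD hA S T)) scaler_sumr.
  apply: eq_bigr => s' _.
  by rewrite (tab_CgRZ hA) scalerA -pureM mul1r mulr1.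
rewrite EE; have := lin_spanZ (pure 1 c) (cell_lower_tagged S T (hq0 s t)).
by rewrite (morph_addB (tab_CgRD hA S T)) scalerBr.
Qed.

(** Two congruences are chained: [tab_mul] produces a sum over S', and [cell_mul_tens] expands each
    summand over s'. The coefficients come from [rho S' S] and the pair (s', s), so they are
    independent of the right-hand index. *)
Lemma induced_mul_pure l (l' : Lamc l) (r : R) (a : A) :
  exists q : M l * Mc l' -> M l * Mc l' -> tens R laurent,
  forall S T : M l * Mc l',
    cell_lower C' (Tagged Lamc l')
      (pure r a * cell_C C' (l := Tagged Lamc l') S T
       - \sum_(S' : M l * Mc l') q S' S *: cell_C C' (l := Tagged Lamc l') S' T).
Proof.
have [rho hrho] := tab_mul hA l a.
have [q hq] := choice (fun p : M l * M l => cell_mul_tens l' r (rho p.1 p.2)).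
exists (fun S' S => q (S'.1, S.1) S'.2 S.2) => -[S s] [T t] /=.
have idD : {morph @id R : x y / x + y} by [].
have pD : {morph (@pure laurent (Gam l) 1) : x y / x + y}.
  by move=> u v; apply: pureDr.
have ED S' := tmapD idD (tab_CgAD hA S' T).
(* [tab_mul] speaks of g in [Gam l]; additivity extends it to coefficients in R, with [x] read in R
   (x) (Z[v,v^-1] (x) Gam l). *)
have low x : cell_lower C' (Tagged Lamc l')
    (pure r a * tab_CgR C S T x - \sum_(S' : M l) tmap id (tab_CgA C S' T)
       (pure r (rho S' S) * tmap id (pure 1) x)).
  move: x; apply: tens_ind => [|r' g x IHx].
    rewrite (morph_add0 (tab_CgRD hA S T)) mulr0 big1 ?subr0; first exact: lin_span0.
    by move=> S' _; rewrite (morph_add0 (tmapD idD pD)) mulr0 (morph_add0 (ED S')).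
  rewrite (tab_CgRD hA) mulrDr (tmapD idD pD).
  under eq_bigr do rewrite mulrDr ED.
  rewrite big_split opprD addrACA /=; apply: lin_spanD IHx.
  rewrite (tab_CgR_pure hA) (tmap_pure _ _ idD pD) -pureM.
  under eq_bigr do rewrite -pureM (tmap_pure _ _ idD (tab_CgAD hA _ T)).
  have prD : {morph (@pure R A (r * r')) : x y / x + y}.
    by move=> u v; apply: pureDr.
  rewrite -(morph_add_sum _ _ _ prD) -(morph_addB prD).
  by apply: cell_lower_pure; apply: hrho.
(* Once the sum over pairs is a double sum, the two congruences add up and their middle terms
   cancel. *)
rewrite -(pair_bigA _ (fun S' s' => q (S', S) s' s *:
  cell_C C' (l := Tagged Lamc l') (S', s') (T, t))) /=.
have := lin_spanD (low (cell_C (Cc l) s t))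
  (lin_span_sum (index_enum (M l)) (P := predT) (fun S' _ => hq (S', S) S' T s t)).
by rewrite sumrB addrA subrK.
Qed.

Lemma induced_mul (p : {l : Lam & Lamc l}) (a : base_change R A) :
  exists q : induced_M M Mc p -> induced_M M Mc p -> tens R laurent,
  forall S T : induced_M M Mc p,
    cell_lower C' p (a * cell_C C' S T
      - \sum_(S' : induced_M M Mc p) q S' S *: cell_C C' S' T).
Proof.
move: a; apply: tens_ind => [|r a x [q hq]].
  exists (fun _ _ => 0) => S T; rewrite mul0r big1 ?subr0; first exact: lin_span0.
  by move=> S' _; rewrite scale0r.
case: p q hq => l l' q hq.
have [q' hq'] := induced_mul_pure l' r a.
exists (fun S' S => q' S' S + q S' S) => S T; rewrite mulrDl.
under eq_bigr do rewrite scalerDl.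
by rewrite big_split opprD addrACA; apply: lin_spanD (hq' S T) (hq S T).
Qed.

Lemma induced_star_C (p : {l : Lam & Lamc l}) (S T : induced_M M Mc p) :
  tmap id star (cell_C C' S T) = cell_C C' T S.
Proof.
case: p S T => l l' [S s] [T t].
by rewrite !induced_CE (star_tab_CgR hA) (cell_star_C (hC l)).
Qed.

End InducedCellDatum.

Theorem theorem2p1p1
  (* the tabular algebra A of finite rank *)
  (d : Order.disp_t) (Lam : finPOrderType d)
  (Gam : Lam -> algebra int) (B : forall l : Lam, set (Gam l))
  (bar : forall l : Lam, Gam l -> Gam l) (M : Lam -> finType)
  (A : algebra laurent) (C : tab_index B M -> A) (star : A -> A)
  (hA : tabular bar C star)
  (hfin : forall l : Lam, finite_set (B l))
  (* the commutative ring R >= Z *)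
  (R : comPzRingType) (hR : injective (fun n : int => n%:~R : R))
  (* the cell data of the R (x) Gam l *)
  (d' : Order.disp_t) (Lamc : Lam -> finPOrderType d')
  (Mc : forall l : Lam, Lamc l -> finType)
  (Cc : forall l : Lam, cell_index (Mc l) -> tens_alg R (Gam l))
  (hC : forall l : Lam, cellular (Cc l) (tmap id (bar l))) :
  cellular (induced_C C Cc) (tmap id star).
Proof.
split.
- exact (induced_inj hA hC hR).
- exact (induced_basis hA hC hR).
- exact (base_change_anti_involution R (tab_star hA)).
- exact (induced_star_C hA hC).
- exact (induced_mul hA hC).
Qed.
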